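(* Let $m\ge 1$ and let $P(X_1,\ldots,X_m)=\sum_{\sigma\in S_m}c_\sigma X_{\sigma(1)}\cdots X_{\sigma(m)}\in\mathbb{Z}\{X_1,\ldots,X_m\}$ be a homogeneous multilinear polynomial. For $1\le i<j\le m$ put $$\Theta_{i,j}(P)=\sum_{\{\sigma\in S_m\,:\,\sigma^{-1}(i)<\sigma^{-1}(j)\}}c_\sigma\in\mathbb{Z}.$$ Then there is a noncommutative ring for which $P=0$ is an identity if and only if there is a prime number $p$ such that the following hold: (1) $p\mid P(1,1,\ldots,1)$; (2) $p\mid\Theta_{i,j}(P)$ for all $1\le i<j\le m$. Moreover, if $p$ is a prime for which (1) and (2) hold, then $P=0$ is an identity for the noncommutative ring $\mathbb{F}_p\{U,V\}/(U^2,V^2,UV)$.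
   Context: All rings are associative with an identity element $1$. A noncommutative ring is a ring that is not commutative. $C\{X_1,\ldots,X_m\}$ denotes the free associative unital $C$-algebra on noncommuting variables. A polynomial $P\in\mathbb{Z}\{X_1,\ldots,X_m\}$ is an identity for a ring $R$ if $P(r_1,\ldots,r_m)=0$ for all $r_1,\ldots,r_m\in R$. $(U^2,V^2,UV)$ denotes the two-sided ideal generated by these elements. *)

(* Defs.v *)
From HB Require Import structures.
From mathcomp Require Import all_fingroup all_boot all_order all_algebra.
From mathcomp Require Import finmap boolp.
From mathcomp.multinomials Require Import monalg.

Set Implicit Arguments.
Unset Strict Implicit.
Unset Printing Implicit Defensive.

Import GRing.Theory.
Local Open Scope ring_scope.
Local Open Scope quotient_scope.

(* Words in m letters form the free monoid {fmonom 'I_m}; its monoid algebra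
   is the free associative unital algebra C{X_0, ..., X_(m-1)}. *)
Notation "{ 'freealg' C [ m ] }" := {malg C[{fmonom 'I_m}]}
  (at level 0, C at level 2, m at level 2,
   format "{ 'freealg'  C [ m ] }") : type_scope.

Definition fvar (C : nzRingType) (m : nat) (i : 'I_m) : {freealg C[m]} :=
  << fmu i >>.

(* P(r_0, ..., r_(m-1)) for integral P.  This is monalg's [mmap] along
   [intr], which is only available for nonzero target rings. *)
Definition feval (R : pzRingType) (m : nat) (P : {freealg int[m]})
    (r : 'I_m -> R) : R :=
  \sum_(w <- msupp P) (P@_w)%:~R * \prod_(i <- (w : seq 'I_m)) r i.

Definition is_identity (R : pzRingType) (m : nat) (P : {freealg int[m]}) :=
  forall r : 'I_m -> R, feval P r = 0.

Definition noncommutative (R : pzRingType) : Prop :=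
  ~ (forall x y : R, x * y = y * x).

Definition multilinear_poly (m : nat) (c : 'S_m -> int) : {freealg int[m]} :=
  \sum_(s : 'S_m) c s *: \prod_(k < m) fvar int (s k).

Definition Theta (m : nat) (c : 'S_m -> int) (i j : 'I_m) : int :=
  \sum_(s : 'S_m | ((s^-1)%g i < (s^-1)%g j)%N) c s.

Section TwoSidedIdeal.
Variable A : pzRingType.

Definition two_sided_ideal (I : A -> Prop) : Prop :=
  [/\ I 0, forall x y, I x -> I y -> I (x - y),
      forall a x, I x -> I (a * x) & forall a x, I x -> I (x * a)].

Definition gen_ideal (G : A -> Prop) (x : A) : Prop :=
  forall I, two_sided_ideal I -> (forall g, G g -> I g) -> I x.

Lemma gen_ideal_ideal (G : A -> Prop) : two_sided_ideal (gen_ideal G).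
Proof.
split=> [I [] //|x y Ix Iy I hI sGI|a x Ix I hI sGI|a x Ix I hI sGI];
  have [I0 IB Il Ir] := hI.
- by apply: IB; [apply: Ix|apply: Iy].
- by apply: Il; apply: Ix.
- by apply: Ir; apply: Ix.
Qed.

End TwoSidedIdeal.

Section RingQuotient.
Variables (A : pzRingType) (G : A -> Prop).

Definition gen_idealb : {pred A} := fun x => `[< gen_ideal G x >].

Lemma gen_idealbP x : reflect (gen_ideal G x) (x \in gen_idealb).
Proof. exact: asboolP. Qed.

Lemma gen_idealb_zmod_closed : zmod_closed gen_idealb.
Proof.
have [I0 IB _ _] := gen_ideal_ideal G.
split=> [|x y /gen_idealbP Ix /gen_idealbP Iy]; apply/gen_idealbP => //.
exact: IB.
Qed.
HB.instance Definition _ :=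
  GRing.isZmodClosed.Build A gen_idealb gen_idealb_zmod_closed.

(* The library's additive quotient; its quotient rings are restricted to
   commutative rings, so the multiplication is added here. *)
Definition quot_ring := Quotient.quot gen_idealb.
HB.instance Definition _ := GRing.Zmodule.on quot_ring.

Definition quot_proj : A -> quot_ring := \pi_(Quotient.quot gen_idealb).

Lemma quot_proj_surj (q : quot_ring) : quot_proj (repr q) = q.
Proof. exact: reprK. Qed.

Lemma quot_proj_eq x y : quot_proj x = quot_proj y <-> gen_ideal G (x - y).
Proof.
split=> [/eqP|/gen_idealbP]; rewrite /quot_proj.
  by rewrite -Quotient.idealrBE => /gen_idealbP.
by rewrite Quotient.idealrBE => /eqP.
Qed.

Definition quot_one : quot_ring := quot_proj 1.
Definition quot_mul (q r : quot_ring) : quot_ring :=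
  quot_proj (repr q * repr r).

Lemma quot_projM x y :
  quot_proj (x * y) = quot_mul (quot_proj x) (quot_proj y).
Proof.
apply/quot_proj_eq; have [I0 IB Il Ir] := gen_ideal_ideal G.
set x' := repr _; set y' := repr _.
have Ix : gen_ideal G (x - x') by apply/quot_proj_eq; rewrite quot_proj_surj.
have Iy : gen_ideal G (y' - y) by apply/quot_proj_eq; rewrite quot_proj_surj.
have -> : x * y - x' * y' = (x - x') * y - x' * (y' - y).
  by rewrite mulrBl mulrBr opprB addrA addrNK.
by apply: IB; [apply: Ir|apply: Il].
Qed.

Lemma quot_mulA : associative quot_mul.
Proof.
move=> x y z; rewrite -[x]quot_proj_surj -[y]quot_proj_surj.
by rewrite -[z]quot_proj_surj -!quot_projM mulrA.
Qed.

Lemma quot_mul1r : left_id quot_one quot_mul.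
Proof. by move=> x; rewrite -[x]quot_proj_surj -quot_projM mul1r. Qed.

Lemma quot_mulr1 : right_id quot_one quot_mul.
Proof. by move=> x; rewrite -[x]quot_proj_surj -quot_projM mulr1. Qed.

Lemma quot_projB : {morph quot_proj : x y / x - y}.
Proof.
by move=> x y; rewrite /quot_proj Quotient.pi_add Quotient.pi_opp.
Qed.

Lemma quot_projD : {morph quot_proj : x y / x + y}.
Proof. by move=> x y; rewrite /quot_proj Quotient.pi_add. Qed.

Lemma quot_mulDl : left_distributive quot_mul +%R.
Proof.
move=> x y z; rewrite -[x]quot_proj_surj -[y]quot_proj_surj.
rewrite -[z]quot_proj_surj -quot_projD -!quot_projM -quot_projD.
by rewrite mulrDl.
Qed.

Lemma quot_mulDr : right_distributive quot_mul +%R.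
Proof.
move=> x y z; rewrite -[x]quot_proj_surj -[y]quot_proj_surj.
rewrite -[z]quot_proj_surj -quot_projD -!quot_projM -quot_projD.
by rewrite mulrDr.
Qed.

HB.instance Definition _ := GRing.Zmodule_isPzRing.Build quot_ring
  quot_mulA quot_mul1r quot_mulr1 quot_mulDl quot_mulDr.

HB.instance Definition _ :=
  GRing.isZmodMorphism.Build A quot_ring quot_proj quot_projB.
HB.instance Definition _ := GRing.isMonoidMorphism.Build A quot_ring quot_proj
  (conj (erefl : quot_proj 1 = 1) quot_projM).

End RingQuotient.

Section UVRing.
Variable p : nat.

Definition varU : {freealg 'F_p[2]} := fvar 'F_p ord0.
Definition varV : {freealg 'F_p[2]} := fvar 'F_p ord_max.

Definition UV_gens (g : {freealg 'F_p[2]}) : Prop :=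
  [\/ g = varU ^+ 2, g = varV ^+ 2 | g = varU * varV].

(* F_p{U,V}/(U^2, V^2, UV), for p prime *)
Definition UV_ring : pzRingType := quot_ring UV_gens.

End UVRing.

Definition divisibility_conditions (m : nat) (c : 'S_m -> int) (p : nat) :=
  (p%:Z %| feval (multilinear_poly c) (fun=> 1 : int))%Z /\
  forall i j : 'I_m, (i < j)%N -> (p%:Z %| Theta c i j)%Z.

(* Main.v *)
(* If P vanishes on R, substituting x for X_i, y for X_j and 1 elsewhere gives
   Theta_ij xy + (P(1) - Theta_ij) yx = 0, and P(1) = 0 in R, so P(1) and all
   Theta_ij annihilate the nonzero element xy - yx; some prime divides all the
   integers annihilating a given nonzero element.
   Conversely every element of F_p{U,V}/(U^2,V^2,UV) is an integer plus an
   element of the span of U, V, VU, and products of three elements of that span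
   vanish.  Expanding P(a + n) by multilinearity leaves only the terms where at
   most two variables are nilpotent and the others are 1, and these have the
   coefficients P(1), Theta_ij and P(1) - Theta_ij. *)
Require Import Defs.
From mathcomp Require Import all_boot all_order all_algebra all_fingroup.
From mathcomp Require Import finmap boolp.
From mathcomp.multinomials Require Import monalg.

Set Implicit Arguments.
Unset Strict Implicit.
Unset Printing Implicit Defensive.

Import GRing.Theory.
Local Open Scope ring_scope.

(** * Evaluation of multilinear polynomials when at most two arguments differ from 1 *)

Section MultilinearEvaluation.
Variable R : pzRingType.

(** Enlarging the index set only adds zero coefficients; additivity uses this to sum P, Q and P + Q
    over one common set of words. *)
Lemma fevalEw m (d : {fset {fmonom 'I_m}}) (P : {freealg int[m]})
    (r : 'I_m -> R) : {subset msupp P <= d} ->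
  feval P r = \sum_(w <- d) (P@_w)%:~R * \prod_(i <- (w : seq 'I_m)) r i.
Proof.
move=> /fsubsetP le; rewrite /feval (big_fset_incl _ le) //= => w _.
by move/mcoeff_outdom->; rewrite mulr0z mul0r.
Qed.

Lemma fevalD m (r : 'I_m -> R) : {morph (fun P => feval P r) : P Q / P + Q}.
Proof.
move=> P Q /=; set d := (msupp P `|` msupp Q)%fset.
rewrite !(@fevalEw _ d); first last.
- exact/fsubsetP/msuppD_le.
- exact/fsubsetP/fsubsetUl.
- exact/fsubsetP/fsubsetUr.
by rewrite -big_split; apply: eq_bigr => w _; rewrite mcoeffD intrD mulrDl.
Qed.

Lemma feval0 m (r : 'I_m -> R) : feval 0 r = 0.
Proof. by rewrite /feval msupp0 big_seq_fset0. Qed.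

Lemma feval_scale_word m (r : 'I_m -> R) (a : int) w :
  feval (a *: << w >>) r = a%:~R * \prod_(i <- (w : seq 'I_m)) r i.
Proof.
rewrite (@fevalEw _ [fset w]%fset) ?big_seq_fset1 ?mcoeffZ ?mcoeffUU ?mulr1 //.
apply/fsubsetP/(fsubset_trans (msuppZ_le _ _)); exact: msuppU_le.
Qed.

Lemma prod_fvar (C : nzRingType) m (s : seq 'I_m) :
  \prod_(i <- s) fvar C i = << FMonom s >>.
Proof.
elim: s => [|i s IHs]; first by rewrite big_nil -fmoneE.
rewrite big_cons IHs /fvar malgM_def /fgmul !msuppU1 !big_seq_fset1.
rewrite !mcoeffUU mulr1; congr << _ *g _ >>.
by apply/eqP; rewrite fmP fmM fmU.
Qed.

Lemma feval_multilinear m (c : 'S_m -> int) (r : 'I_m -> R) :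
  feval (multilinear_poly c) r = \sum_s (c s)%:~R * \prod_k r (s k).
Proof.
rewrite /multilinear_poly (big_morph _ (fevalD r) (feval0 r)).
apply: eq_bigr => s _.
rewrite -(big_map s xpredT (@fvar _ m)) prod_fvar feval_scale_word /=.
by rewrite big_map.
Qed.

Lemma ltn_ord_trans m : transitive (fun i j : 'I_m => (i < j)%N).
Proof. by move=> j i k; apply: ltn_trans. Qed.

Lemma filter_ord_sorted m (P : pred 'I_m) :
  sorted (fun i j : 'I_m => (i < j)%N) [seq i <- enum 'I_m | P i].
Proof.
apply: sorted_filter; first exact: ltn_ord_trans.
by rewrite -(sorted_map (e' := ltn) (f := val)) val_enum_ord iota_ltn_sorted.
Qed.

(** Two strictly increasing lists with the same members coincide. *)
Lemma filter_mem_enum_ord m (s : seq 'I_m) :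
    sorted (fun i j : 'I_m => (i < j)%N) s ->
  [seq i <- enum 'I_m | i \in s] = s.
Proof.
move=> s_sorted; apply: (irr_sorted_eq (@ltn_ord_trans m)) => //.
- by move=> i; apply: ltnn.
- exact: filter_ord_sorted.
- by move=> i; rewrite mem_filter mem_enum andbT.
Qed.

Lemma prod_ord_filter m (P : pred 'I_m) (F : 'I_m -> R) :
    (forall k, ~~ P k -> F k = 1) ->
  \prod_k F k = \prod_(k <- [seq k <- enum 'I_m | P k]) F k.
Proof.
move=> F1; rewrite big_filter enumT [RHS]big_mkcond /=.
by apply: eq_bigr => k _; case: ifPn => // /F1.
Qed.

Lemma prod_ord1 m (i : 'I_m) (F : 'I_m -> R) :
  (forall k, k != i -> F k = 1) -> \prod_k F k = F i.
Proof.
move=> F1; rewrite (@prod_ord_filter _ (mem [:: i])).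
  by rewrite filter_mem_enum_ord // big_seq1.
by move=> k /=; rewrite inE; apply: F1.
Qed.

Lemma prod_ord2 m (i j : 'I_m) (F : 'I_m -> R) : (i < j)%N ->
  (forall k, k != i -> k != j -> F k = 1) -> \prod_k F k = F i * F j.
Proof.
move=> ltij F1; rewrite (@prod_ord_filter _ (mem [:: i; j])).
  by rewrite filter_mem_enum_ord /= ?ltij // big_cons big_seq1.
by move=> k /=; rewrite !inE negb_or => /andP[]; apply: F1.
Qed.

Lemma feval_multilinear1 m (c : 'S_m -> int) (r : 'I_m -> R) :
  (forall k, r k = 1) ->
  feval (multilinear_poly c) r = (\sum_s c s)%:~R.
Proof.
move=> r1; rewrite feval_multilinear rmorph_sum; apply: eq_bigr => s _.
by rewrite big1 ?mulr1.
Qed.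

Lemma feval_multilinear_var1 m (c : 'S_m -> int) (i : 'I_m) (r : 'I_m -> R) :
  (forall k, k != i -> r k = 1) ->
  feval (multilinear_poly c) r = (\sum_s c s)%:~R * r i.
Proof.
move=> r1; rewrite feval_multilinear rmorph_sum mulr_suml.
apply: eq_bigr => s _; rewrite (@prod_ord1 _ (s^-1%g i)) ?permKV // => k.
by rewrite -(inj_eq (@perm_inj _ s)) permKV; apply: r1.
Qed.

(** The variables i and j sit at positions [s^-1 i] and [s^-1 j] of the monomial of [s]. The order
    of these positions decides whether the monomial becomes [r i * r j] or [r j * r i]. *)
Lemma feval_multilinear_var2 m (c : 'S_m -> int) (i j : 'I_m) (r : 'I_m -> R) :
  i != j -> (forall k, k != i -> k != j -> r k = 1) ->
  feval (multilinear_poly c) r =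
    (Theta c i j)%:~R * (r i * r j)
    + (\sum_s c s - Theta c i j)%:~R * (r j * r i).
Proof.
move=> neq_ij r1; rewrite feval_multilinear.
rewrite (bigID (fun s : 'S_m => (s^-1%g i < s^-1%g j)%N)) /=.
have -> : \sum_s c s - Theta c i j
    = \sum_(s : 'S_m | ~~ (s^-1%g i < s^-1%g j)%N) c s.
  rewrite [X in X - _](bigID (fun s : 'S_m => (s^-1%g i < s^-1%g j)%N)) /=.
  by apply/eqP; rewrite subr_eq addrC.
have r1s (s : 'S_m) k : k != s^-1%g i -> k != s^-1%g j -> r (s k) = 1.
  rewrite -!(inj_eq (@perm_inj _ s) k) !permKV; exact: r1.
rewrite !rmorph_sum !mulr_suml; congr (_ + _); apply: eq_bigr => s lt_ij.
  by rewrite (prod_ord2 lt_ij) ?permKV // => k; apply: r1s.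
have lt_ji : (s^-1%g j < s^-1%g i)%N.
  by rewrite ltn_neqAle leqNgt lt_ij val_eqE (inj_eq perm_inj) eq_sym neq_ij.
by rewrite (prod_ord2 lt_ji) ?permKV // => k kj ki; apply: r1s.
Qed.

End MultilinearEvaluation.

(** * From an identity of a noncommutative ring to a prime *)

Lemma prime_dvd_annihilator (V : zmodType) (z : V) : z != 0 ->
  exists2 p : nat, prime p & forall k : int, z *~ k = 0 -> (p%:Z %| k)%Z.
Proof.
move=> z_neq0.
have [torsion_z | free_z] := pselect (exists n, (0 < n)%N && (z *+ n == 0)).
  (* Here [n] is the additive order of [z], and any prime factor of [n] serves; there is one because
     [n = 1] would give [z = 0]. *)
  case: (ex_minnP torsion_z) => n /andP[n_gt0 /eqP zn0] n_min.
  have n_gt1 : (1 < n)%N.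
    rewrite ltn_neqAle n_gt0 andbT; apply: contra_neq z_neq0 => n1.
    by rewrite -n1 mulr1n in zn0.
  exists (pdiv n); first exact: pdiv_prime.
  move=> k zk0; apply: (@dvdz_trans n%:Z); first exact: pdiv_dvd.
  apply/dvdz_mod0P; have : z *~ (k %% n)%Z = 0.
    by rewrite /modz mulrzBr zk0 mulrC mulrzA -pmulrn zn0 mul0rz subrr.
  (* The remainder of [k] modulo [n] also annihilates [z], so a positive value would contradict the
     minimality of [n]. *)
  have := ltz_pmod k (_ : (0 < n%:Z)%R); have := @modz_ge0 k n%:Z.
  case: (k %% n)%Z => [[|r]|r] //.
    move=> _ /(_ n_gt0); rewrite ltz_nat => lt_rn zr0.
    by have := n_min r.+1; rewrite /= pmulrn zr0 eqxx leqNgt lt_rn => /(_ isT).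
  by rewrite -lt0n n_gt0 => /(_ isT).
(* If [z] has infinite order, only 0 annihilates it, so any prime will do. *)
exists 2%N => // k zk0; suff -> : k = 0 by rewrite dvdz0.
apply: contra_notP free_z => /eqP k_neq0; exists `|k|%N.
rewrite absz_gt0 k_neq0.
by case: k zk0 {k_neq0} => n /eqP //; rewrite NegzE mulrNz oppr_eq0.
Qed.

Lemma prime_of_noncommutative_identity (R : pzRingType) m (c : 'S_m -> int) :
    noncommutative R -> is_identity R (multilinear_poly c) ->
  exists2 p : nat, prime p & divisibility_conditions c p.
Proof.
move=> /existsNP[x /existsNP[y neq_xy]] idR.
have comm_neq0 : x * y - y * x != 0 by rewrite subr_eq0; apply/eqP.
have [p p_pr p_dvd] := prime_dvd_annihilator comm_neq0.
have S0 : (\sum_s c s)%:~R = 0 :> R.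
  by rewrite -(idR (fun=> 1)) feval_multilinear1.
exists p => //; split=> [|i j lt_ij].
  rewrite feval_multilinear1 // intz.
  by apply: p_dvd; rewrite -mulrzl S0 mul0r.
have neq_ij : i != j by rewrite -val_eqE neq_ltn lt_ij.
apply: p_dvd.
have := idR (fun k => if k == i then x else if k == j then y else 1).
rewrite (feval_multilinear_var2 _ neq_ij); last first.
  by move=> k /negPf-> /negPf->.
rewrite !eqxx (eq_sym j) (negPf neq_ij) rmorphB /= S0 sub0r mulNr.
by rewrite -mulrBr mulrzl.
Qed.

(** * Identities in rings whose elements are integers plus nilpotent parts *)

Section ScalarPlusNilpotent.
Variables (R : pzRingType) (m : nat) (c : 'S_m -> int).

Lemma prod_intr_mul I (s : seq I) (z : I -> int) (y : I -> R) :
  \prod_(i <- s) ((z i)%:~R * y i) =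
    (\prod_(i <- s) z i)%:~R * \prod_(i <- s) y i.
Proof.
elim: s => [|i s IHs]; first by rewrite !big_nil mulr1.
rewrite !big_cons IHs intrM -!mulrA; congr (_ * _).
by rewrite !mulrA (commr_int (y i)).
Qed.

(** The choice [f] between scalar and nilpotent part is indexed by variables instead of positions,
    so that it means the same for every [s] and the sums over [f] and [s] can be exchanged. *)
Lemma prod_scalar_add_perm (a : 'I_m -> int) (n : 'I_m -> R) (s : 'S_m) :
  \prod_k ((a (s k))%:~R + n (s k)) =
    \sum_(f : {ffun 'I_m -> bool})
      \prod_k (if f (s k) then n (s k) else (a (s k))%:~R).
Proof.
pose F k (b : bool) := if b then n (s k) else (a (s k))%:~R.
have -> : \prod_k ((a (s k))%:~R + n (s k)) = \prod_k \sum_b F k b.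
  by apply: eq_bigr => k _; rewrite big_bool /F addrC.
rewrite bigA_distr_bigA.
pose perm_ffun (t : 'S_m) (f : {ffun 'I_m -> bool}) := [ffun k => f (t k)].
have perm_ffun_bij : bijective (perm_ffun s).
  by exists (perm_ffun s^-1%g) => f; apply/ffunP => k;
    rewrite !ffunE ?permK ?permKV.
rewrite (reindex (perm_ffun s)) /=; last exact: onW_bij.
by apply: eq_bigr => f _; apply: eq_bigr => k _; rewrite ffunE.
Qed.

Lemma feval_multilinear_scalar_add (a : 'I_m -> int) (n : 'I_m -> R) :
  feval (multilinear_poly c) (fun i => (a i)%:~R + n i) =
    \sum_(f : {ffun 'I_m -> bool}) (\prod_(i | ~~ f i) a i)%:~R *
      feval (multilinear_poly c) (fun i => if f i then n i else 1).
Proof.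
rewrite feval_multilinear.
under eq_bigr do rewrite prod_scalar_add_perm mulr_sumr.
rewrite exchange_big /=; apply: eq_bigr => f _.
rewrite feval_multilinear mulr_sumr; apply: eq_bigr => s _.
(* The integers chosen by [f] are central and their product is the same for all [s]; moving it to
   the positions of [s] allows it to be merged factor by factor. *)
rewrite mulrA -intrM mulrC intrM -mulrA; congr (_ * _).
rewrite [in RHS]big_mkcond (reindex_inj (@perm_inj _ s)) /= -prod_intr_mul.
by apply: eq_bigr => k _; case: (f (s k)); rewrite ?mul1r ?mulr1.
Qed.

Lemma prod_nilpotent3 (N : R -> Prop) I (s : seq I) (F : I -> R) :
    (forall x y z, N x -> N y -> N z -> x * y * z = 0) ->
    (forall i, N (F i)) -> (2 < size s)%N ->
  \prod_(i <- s) F i = 0.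
Proof.
move=> N3 NF; case: s => [|i [|j [|k s]]] // _.
by rewrite !big_cons !mulrA (N3 (F i)) ?mul0r.
Qed.

Lemma identity_scalar_add_nilpotent p (N : R -> Prop) :
    p%:R = 0 :> R -> divisibility_conditions c p ->
    (forall x y z, N x -> N y -> N z -> x * y * z = 0) ->
    (forall x, exists an : int * R, N an.2 /\ x = an.1%:~R + an.2) ->
  is_identity R (multilinear_poly c).
Proof.
move=> p0 [pS pTheta] N3 decR r.
have dvd0 (k : int) : (p%:Z %| k)%Z -> k%:~R = 0 :> R.
  by case/dvdzP=> q ->; rewrite intrM -pmulrn p0 mulr0.
have S0 : (\sum_s c s)%:~R = 0 :> R.
  by apply: dvd0; rewrite feval_multilinear1 // intz in pS.
have [an dec_r] := boolp.choice (fun i => decR (r i)).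
have -> : r = (fun i => (an i).1%:~R + (an i).2).
  by apply/funext => i; have [] := dec_r i.
have Nn i : N (an i).2 by have [] := dec_r i.
rewrite feval_multilinear_scalar_add big1 // => f _.
set h := (X in feval _ X).
suff -> : feval (multilinear_poly c) h = 0 by rewrite mulr0.
have h1 i : ~~ f i -> h i = 1 by rewrite /h => /negPf->.
have f_sorted := filter_ord_sorted f.
have f_enum i : (i \in [seq i <- enum 'I_m | f i]) = f i.
  by rewrite mem_filter mem_enum andbT.
(* Cases on the number of variables taking nilpotent values. Listing them in increasing order
   provides the [i < j] that condition (2) requires. *)
case Df: [seq i <- enum 'I_m | f i] f_sorted f_enum
  => [|i [|j [|k t]]] f_sorted f_enum.
- rewrite feval_multilinear1 // => i; apply: h1.
  by have := f_enum i; rewrite inE => <-.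
- rewrite (feval_multilinear_var1 c (i := i)) ?S0 ?mul0r // => k ki.
  by apply: h1; have := f_enum k; rewrite !inE (negPf ki) => <-.
- have lt_ij : (i < j)%N by case/andP: f_sorted.
  rewrite (feval_multilinear_var2 c (i := i) (j := j)).
  + by rewrite rmorphB /= S0 dvd0 ?pTheta // !mul0r subrr mul0r addr0.
  + by rewrite -val_eqE neq_ltn lt_ij.
  + move=> k ki kj; apply: h1; have := f_enum k.
    by rewrite !inE (negPf ki) (negPf kj) => <-.
rewrite feval_multilinear big1 // => s _.
rewrite (@prod_ord_filter _ _ (fun k => f (s k))); last by move=> l; apply: h1.
rewrite big_filter (eq_bigr (fun l => (an (s l)).2)) => [|l fl]; last first.
  by rewrite /h fl.
rewrite -big_filter (prod_nilpotent3 N3) ?mulr0 //.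
(* A permutation preserves the number of indices satisfying [f], so every monomial keeps at least
   three nilpotent factors. *)
have perm_s : perm_eq (map s (enum 'I_m)) (enum 'I_m).
  apply: uniq_perm; rewrite ?(map_inj_uniq perm_inj) ?enum_uniq // => l.
  by rewrite mem_enum; apply/mapP; exists (s^-1%g l); rewrite ?mem_enum ?permKV.
rewrite size_filter -(count_map s f) (seq.permP perm_s) -size_filter.
by rewrite Df.
Qed.

End ScalarPlusNilpotent.

(** * Consequences of the relations uu = vv = uv = 0 *)

Section UVRelations.
Variables (R : pzRingType) (u v : R).
Hypotheses (uu0 : u * u = 0) (vv0 : v * v = 0) (uv0 : u * v = 0).

(** Integer multiples make sense in every ring; once p = 0 they give the span over the field with p
    elements. *)
Definition UV_span (x : R) : Prop :=
  exists a b d : int, x = u *~ a + v *~ b + (v * u) *~ d.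

(** No letter can follow vu: every word of length at least three in u and v contains uu, vv or
    uv. *)
Lemma UV_span_mul3 x y z : UV_span x -> UV_span y -> UV_span z -> x * y * z = 0.
Proof.
move=> [a [b [d ->]]] [a' [b' [d' ->]]] [a'' [b'' [d'' ->]]].
rewrite !mulrDl !mulrDr !(mulrzAl, mulrzAr) !mulrA.
rewrite -!(mulrA v u) !(uu0, uv0, vv0, mul0r, mulr0, mul0rz, add0r, addr0).
rewrite !mulrzAl -!mulrA !(mulrA u) !(uu0, uv0).
by rewrite !(mul0r, mulr0, mul0rz, addr0).
Qed.

Definition UV_decomposable (x : R) : Prop :=
  exists an : int * R, UV_span an.2 /\ x = an.1%:~R + an.2.

Lemma UV_decomposableD x y :
  UV_decomposable x -> UV_decomposable y -> UV_decomposable (x + y).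
Proof.
move=> [[k _] /= [[a [b [d ->]]] ->]] [[k' _] /= [[a' [b' [d' ->]]] ->]].
exists (k + k', u *~ (a + a') + v *~ (b + b') + (v * u) *~ (d + d')).
split; first by do 3!eexists.
rewrite /= !mulrzDr addrACA; congr (_ + _).
by rewrite addrACA; congr (_ + _); rewrite addrACA.
Qed.

(** Only the integer part of [x] survives multiplication by [u]. Left multiplication by single
    letters is the induction step for words in [UV_ring_decomposable]. *)
Lemma UV_decomposable_mulu x : UV_decomposable x -> UV_decomposable (u * x).
Proof.
move=> [[k _] /= [[a [b [d ->]]] ->]]; exists (0, u *~ k); split.
  by exists k, 0, 0; rewrite !mulr0z !addr0.
rewrite /= add0r !mulrDr !mulrzAr mulr1 mulrA uu0 uv0.
by rewrite mul0r !mul0rz !addr0.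
Qed.

Lemma UV_decomposable_mulv x : UV_decomposable x -> UV_decomposable (v * x).
Proof.
move=> [[k _] /= [[a [b [d ->]]] ->]]; exists (0, v *~ k + (v * u) *~ a); split.
  by exists 0, k, a; rewrite mulr0z add0r.
rewrite /= add0r !mulrDr !mulrzAr mulr1 mulrA vv0.
by rewrite mul0r !mul0rz !addr0.
Qed.

Lemma UV_decomposable1 : UV_decomposable 1.
Proof.
exists (1, 0); split; last by rewrite addr0.
by exists 0, 0, 0; rewrite !mulr0z !addr0.
Qed.

End UVRelations.

Lemma quot_proj_gen0 (A : pzRingType) (G : A -> Prop) x :
  G x -> quot_proj G x = 0.
Proof.
move=> Gx; rewrite -(rmorph0 (quot_proj G)); apply/quot_proj_eq.
by rewrite subr0 => I _; apply.
Qed.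

(** * Structure of the quotient by U^2, V^2 and UV *)

Section UVRing.
Variable p : nat.
Local Notation pi := (quot_proj (@UV_gens p)).

Lemma UV_ring_relations :
  [/\ pi (varU p) * pi (varU p) = 0, pi (varV p) * pi (varV p) = 0
    & pi (varU p) * pi (varV p) = 0].
Proof.
rewrite -!rmorphM; split; apply: quot_proj_gen0.
- exact: Or31.
- exact: Or32.
- exact: Or33.
Qed.

Lemma UV_ring_decomposable (x : UV_ring p) :
  UV_decomposable (pi (varU p)) (pi (varV p)) x.
Proof.
have [uu0 vv0 uv0] := UV_ring_relations.
set D := UV_decomposable _ _.
have decD a b : D a -> D b -> D (a + b) by exact: UV_decomposableD.
have dec0 : D 0.
  by exists (0, 0); split; last rewrite addr0;
    first (exists 0, 0, 0; rewrite !mulr0z !addr0).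
have decMn a n : D a -> D (a *+ n).
  by move=> Da; elim: n => [|n IHn] //; rewrite mulrS; apply: decD.
rewrite -[x]quot_proj_surj; set y := (X in quot_proj _ X).
rewrite [y]monalgE rmorph_sum /=.
(* A coefficient in ['F_p] is the image of a natural number, so each term is a natural multiple of a
   word, which is then treated by induction on its letters. *)
apply: big_ind => // w _; rewrite -[y@_w]natr_Zp monalgUMn raddfMn.
apply: decMn; rewrite -[w]fmK -prod_fvar /= (rmorph_prod (quot_proj _)).
elim: (w : seq _) => [|i s IHs].
  by rewrite big_nil; apply: UV_decomposable1.
rewrite big_cons; case: (unliftP ord0 i) => [j ->|->].
  rewrite (_ : lift ord0 j = ord_max); last by apply/val_inj; case: j => -[].
  exact: (UV_decomposable_mulv vv0 IHs).
exact: (UV_decomposable_mulu uu0 uv0 IHs).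
Qed.

Lemma UV_ring_noncommutative : noncommutative (UV_ring p).
Proof.
move=> /(_ (pi (varV p)) (pi (varU p))).
(* The words that are factors of VU form a factor-closed set, so the elements
   whose coefficients vanish on them form an ideal. *)
pose J (x : {freealg 'F_p[2]}) :=
  forall w : {fmonom 'I_2}, infix (w : seq 'I_2) [:: ord_max; ord0] -> x@_w = 0.
rewrite -!rmorphM => /quot_proj_eq /(_ J).
have idealJ : two_sided_ideal J.
  split=> [w _|x y Jx Jy w sw|a x Jx w sw|a x Jx w sw].
  - by rewrite mcoeff0.
  - by rewrite mcoeffB Jx ?Jy ?subrr.
  (* The coefficient of a product at [w] involves only splittings of [w] as [w1 w2], and both pieces
     are again factors of VU. *)
  - rewrite mcoeffMl big1 // => w1 _; rewrite big1 // => w2 _.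
    case: eqP => // Dw; rewrite Jx ?mulr0 //; apply: infix_trans sw.
    by rewrite -Dw fmM suffix_infix.
  - rewrite mcoeffMl big1 // => w1 _; rewrite big1 // => w2 _.
    case: eqP => // Dw; rewrite Jx ?mul0r //; apply: infix_trans sw.
    by rewrite -Dw fmM prefix_infix.
have varM (i j : 'I_2) : fvar 'F_p i * fvar 'F_p j = << FMonom [:: i; j] >>.
  by rewrite -prod_fvar !big_cons big_nil mulr1.
(* A word of length two that is a factor of VU is VU itself, so the other three products of two
   variables lie in [J]; these are the generators. *)
have JU i j : (i, j) != (ord_max, ord0) -> J (fvar 'F_p i * fvar 'F_p j).
  move=> neq_ij w sw; rewrite varM mcoeffU1.
  case: eqP sw => // <- /infixP[[|a [|b s1]] [s2]] //=; last by case: s1.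
  by case=> eq_i eq_j _; rewrite -eq_i -eq_j eqxx in neq_ij.
move=> /(_ idealJ) JVU.
have {JVU} JVU : J (varV p * varU p - varU p * varV p).
  by apply: JVU => g [] ->; rewrite ?expr2; apply: JU.
(* The coefficient at the word VU vanishes on [J] but equals 1 on VU - UV. *)
have VU1 : (varV p * varU p)@_(FMonom [:: ord_max; ord0]) = 1.
  by rewrite varM mcoeffUU.
have UV0 : (varU p * varV p)@_(FMonom [:: ord_max; ord0]) = 0.
  by rewrite varM mcoeffU1 fmP.
have /subr0_eq VU_UV : (varV p * varU p)@_(FMonom [:: ord_max; ord0])
    - (varU p * varV p)@_(FMonom [:: ord_max; ord0]) = 0.
  by rewrite -mcoeffB; apply: JVU; apply: infix_refl.
by have /eqP := etrans (esym VU1) (etrans VU_UV UV0); rewrite oner_eq0.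
Qed.

End UVRing.

Theorem theorem1p2 (m : nat) (hm : (1 <= m)%N) (c : 'S_m -> int) :
  ((exists R : pzRingType, noncommutative R /\ is_identity R (multilinear_poly c))
     <-> exists p : nat, prime p /\ divisibility_conditions c p)
  /\ forall p : nat, prime p -> divisibility_conditions c p ->
       noncommutative (UV_ring p) /\ is_identity (UV_ring p) (multilinear_poly c).
Proof.
have UV_id p : prime p -> divisibility_conditions c p ->
    noncommutative (UV_ring p) /\ is_identity (UV_ring p) (multilinear_poly c).
  move=> p_pr c_p; split; first exact: UV_ring_noncommutative.
  have [uu0 vv0 uv0] := UV_ring_relations p.
  apply: (identity_scalar_add_nilpotent _ c_p (UV_span_mul3 uu0 vv0 uv0)).
    (* For p prime, p is zero in ['F_p], hence in the free algebra and its quotient. *)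
    rewrite -(rmorph_nat (quot_proj _)) -mpolyC_nat pchar_Fp_0 //.
    by rewrite malgC0E rmorph0.
  exact: UV_ring_decomposable.
split=> //; split=> [[R [ncR idR]]|[p [p_pr c_p]]].
  by have [p p_pr c_p] := prime_of_noncommutative_identity ncR idR; exists p.
by exists (UV_ring p); apply: UV_id.
Qed.
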